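(* $\mathrm{nfc}(\mathcal{UHIT}_{\delta=6})^{\max} = \mathrm{nfc}(\mathcal{MU}_{\delta=6})^{\max} = \mathrm{minvdeg}(\mathcal{UHIT}_{\delta=6}) = \mathrm{minvdeg}(\mathcal{MU}_{\delta=6}) = 8 = \mathrm{N}(6) - 1$. Here $\mathrm{nfc}(\mathcal{D})^{\max}$ denotes the maximum (supremum) of $\mathrm{nfc}(F)$ over $F \in \mathcal{D}$.
   Context: Literals come with a fixed-point-free involution $x \mapsto \overline{x}$; variables are positive literals. A clause is a finite set $C$ of literals with $C \cap \overline{C} = \emptyset$; a clause-set is a finite set of clauses. $\mathrm{var}(F)$, $n(F) = |\mathrm{var}(F)|$, $c(F) = |F|$, $\delta(F) = c(F) - n(F)$. $F$ is satisfiable iff some assignment of truth values to variables makes a literal of every clause true. $\mathcal{MU}$ is the class of minimally unsatisfiable clause-sets ($F$ unsatisfiable, $F \setminus \{C\}$ satisfiable for all $C \in F$). $F$ is hitting if for all distinct $C, D \in F$ we have $C \cap \overline{D} \ne \emptyset$; $\mathcal{UHIT}$ is the class of unsatisfiable hitting clause-sets. $\mathcal{C}_{\delta = k} = \{F \in \mathcal{C} : \delta(F) = k\}$. A clause $C \in F$ is full if $\mathrm{var}(C) = \mathrm{var}(F)$; $\mathrm{nfc}(F)$ is the number of full clauses of $F$. $\mathrm{ld}_F(x)$ is the number of clauses of $F$ containing $x$, $\mathrm{vdeg}_F(v) = \mathrm{ld}_F(v)+\mathrm{ld}_F(\overline{v})$, $\mathrm{minvdeg}(F) = \min_{v \in \mathrm{var}(F)}\mathrm{vdeg}_F(v)$;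 for a class $\mathcal{D}$, $\mathrm{minvdeg}(\mathcal{D})$ is the supremum of $\mathrm{minvdeg}(F)$ over $F \in \mathcal{D}$ with $n(F) > 0$. $\mathrm{N}(1) = 2$, $\mathrm{N}(k) = \max_{i \in \{2,\dots,k\}} \min(2i, \mathrm{N}(k-i+1)+i)$ for $k \ge 2$ (so $\mathrm{N}(6) = 9$). *)

(* Defs.v *)
From HB Require Import structures.
From mathcomp Require Import all_boot all_order all_algebra.
From mathcomp Require Import finmap.
Set Implicit Arguments. Unset Strict Implicit. Unset Printing Implicit Defensive.
Local Open Scope fset_scope.

(* Variables are natural numbers; a literal is a pair (v, b):
   (v, true) is the positive literal v, (v, false) is its complement. *)
Definition var_t := nat.
Definition lit := (nat * bool)%type.
Definition compl (x : lit) : lit := (x.1, ~~ x.2).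

Definition clause := {fset lit}.
Definition clauseset := {fset clause}.

Definition is_clause (C : clause) : Prop := forall x, x \in C -> compl x \notin C.
Definition is_clauseset (F : clauseset) : Prop := forall C, C \in F -> is_clause C.

Definition varC (C : clause) : {fset nat} := [fset x.1 | x in C].
Definition varF (F : clauseset) : {fset nat} := \bigcup_(C <- F) varC C.
Definition nF (F : clauseset) : nat := #|` varF F|.
Definition cF (F : clauseset) : nat := #|` F|.
Definition delta (F : clauseset) : int := (Posz (cF F) - Posz (nF F))%R.

Definition satisfiable (F : clauseset) : Prop :=
  exists f : nat -> bool, forall C, C \in F -> exists2 x, x \in C & f x.1 = x.2.

Definition MU (F : clauseset) : Prop :=
  is_clauseset F /\ ~ satisfiable F /\
  forall C, C \in F -> satisfiable (F `\ C).

Definition hitting (F : clauseset) : Prop :=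
  forall C D, C \in F -> D \in F -> C != D -> exists2 x, x \in C & compl x \in D.

Definition UHIT (F : clauseset) : Prop :=
  is_clauseset F /\ hitting F /\ ~ satisfiable F.

Definition MU_delta (k : int) (F : clauseset) : Prop := MU F /\ delta F = k.
Definition UHIT_delta (k : int) (F : clauseset) : Prop := UHIT F /\ delta F = k.

Definition nfc (F : clauseset) : nat := #|` [fset C in F | varC C == varF F]|.

Definition ld (F : clauseset) (x : lit) : nat := #|` [fset C in F | x \in C]|.
Definition vdeg (F : clauseset) (v : nat) : nat := ld F (v, true) + ld F (v, false).

(* minimum variable degree; the seed c(F) is harmless since every
   vdeg_F(v) <= c(F) (a clause cannot contain both v and its complement). *)
Definition minvdeg (F : clauseset) : nat :=
  \big[minn/cF F]_(v <- varF F) vdeg F v.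

Definition sup_is (D : clauseset -> Prop) (g : clauseset -> nat) (m : nat) : Prop :=
  (forall F, D F -> g F <= m) /\ (exists F, D F /\ g F = m).

Definition minvdeg_class_is (D : clauseset -> Prop) (m : nat) : Prop :=
  sup_is (fun F => D F /\ 0 < nF F) minvdeg m.

Fixpoint Nfuel (fuel k : nat) : nat :=
  match fuel with
  | 0 => 2
  | fuel'.+1 =>
      if k <= 1 then 2
      else \max_(2 <= i < k.+1) minn (2 * i) (Nfuel fuel' (k - i + 1) + i)
  end.
Definition N (k : nat) : nat := Nfuel k k.

(* Main.v *)
Require Import Defs.
From mathcomp Require Import all_boot all_order all_algebra.
From mathcomp Require Import finmap.
From mathcomp Require Import zify.
Set Implicit Arguments. Unset Strict Implicit. Unset Printing Implicit Defensive.

(* A full clause contains every variable, so nfc <= minvdeg, and a hitting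
   clause-set with n = 4, c = 10 and 8 full clauses gives the lower bounds; what
   has to be shown is that no minimally unsatisfiable F of deficiency 6 has all
   variable degrees >= 9.  Add literals to F until it is saturated: then setting
   a literal x true keeps minimal unsatisfiability, and if no variable
   disappears the deficiency drops by ld(x) - 1.  Unit clauses can be removed
   this way.  Otherwise a variable v of minimal degree must occur 5 times in one
   sign and 4 times in the other, and the two ways of setting v leave G of
   deficiency 2 and H of deficiency 3.  H has two variables of degree 5; they
   occur in all four clauses removed to get H, so G has no unit clause either.
   Then every variable of G has degree 4 in G, and therefore occurs in all five
   clauses removed to get G.  These five clauses are full in H, and a variable
   of degree 5 in H occurs in no others, with signs 3 + 2; but flipping that
   variable maps the three injectively into the two. *)

(** * Clause-sets as matrices *)

(* [lia] without the irrelevant hypotheses, whose preprocessing is very slow. *)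
Ltac card_lia :=
  intros;
  repeat match goal with
  | H : ?T |- _ =>
    lazymatch T with
    | is_true (leq _ _) => fail
    | @eq nat _ _ => fail
    | ~ @eq _ _ _ => fail
    | _ => clear H
    end
  end; lia.

Section Matrix.
Variables I V : finType.
Implicit Types (A B : I -> V -> option bool) (J D : {set I}) (X Z : {set V}).
Implicit Types (f g : {ffun V -> bool}) (i j : I) (v w z : V) (b c : bool).

(* Clause [i] contains the literal [(v, b)] iff [A i v = Some b].  [J] and [X]
   select clauses and variables, so that reductions stay inside one matrix. *)
Definition falsified A X f i := [forall v in X, A i v != Some (f v)].
Definition unsat A J X := [forall f, [exists i in J, falsified A X f i]].
Definition critical A J X f i :=
  falsified A X f i && [forall j in J, falsified A X f j ==> (j == i)].
Definition mu A J X :=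
  unsat A J X && [forall i in J, [exists f, critical A J X f i]].
(** Adding [(v, b)] to row [i] would turn this [f] into a model: no missing literal can be added
    without losing unsatisfiability. *)
Definition saturated A J X :=
  forall i v b, i \in J -> v \in X -> A i v != Some b ->
  exists2 f, critical A J X f i & f v = b.
Definition ldeg A J v b := #|[set i in J | A i v == Some b]|.
Definition deg A J v := #|[set i in J | A i v != None]|.
Definition occ A J X := forall v, v \in X -> exists2 i, i \in J & A i v != None.
Definition extends A B := forall i v b, A i v = Some b -> B i v = Some b.

Definition upd f v b : {ffun V -> bool} := [ffun w => if w == v then b else f w].

Lemma updE f v b w : upd f v b w = if w == v then b else f w.
Proof. by rewrite ffunE. Qed.

Lemma falsifiedP A X f i :
  reflect (forall v, v \in X -> A i v != Some (f v)) (falsified A X f i).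
Proof. exact: forall_inP. Qed.

Lemma unsatP A J X :
  reflect (forall f, exists2 i, i \in J & falsified A X f i) (unsat A J X).
Proof.
apply: (iffP forallP) => H f; first exact/exists_inP.
by apply/exists_inP.
Qed.

Lemma criticalP A J X f i :
  reflect (falsified A X f i /\ forall j, j \in J -> falsified A X f j -> j = i)
          (critical A J X f i).
Proof.
apply: (iffP andP) => -[Hi H]; split=> //.
  by move=> j jJ jf; apply/eqP; move/forall_inP: H => /(_ j jJ) /implyP /(_ jf).
by apply/forall_inP => j jJ; apply/implyP => jf; apply/eqP/H.
Qed.

Lemma muP A J X :
  reflect ((forall f, exists2 i, i \in J & falsified A X f i) /\
           forall i, i \in J -> exists f, critical A J X f i)
          (mu A J X).
Proof.
apply: (iffP andP) => -[/unsatP H1 H2]; split=> //.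
  by move=> i iJ; apply/existsP; move/forall_inP: H2 => /(_ i iJ).
by apply/forall_inP => i iJ; apply/existsP/H2.
Qed.

Lemma card_deg A J v : deg A J v = ldeg A J v true + ldeg A J v false.
Proof.
rewrite /deg -(cardsID [set i | A i v == Some true]); congr (_ + _).
  by apply: eq_card => i; rewrite !inE; case: (A i v) => [[]|]; rewrite /= ?andbT ?andbF.
by apply: eq_card => i; rewrite !inE; case: (A i v) => [[]|]; rewrite /= ?andbT ?andbF.
Qed.

Lemma deg_ldeg A J v b : deg A J v = ldeg A J v b + ldeg A J v (~~ b).
Proof. by rewrite card_deg; case: b; rewrite //= addnC. Qed.

Lemma occ_deg A J X : (forall v, v \in X -> 0 < deg A J v) -> occ A J X.
Proof.
move=> H v /H; rewrite card_gt0 => /set0Pn [i]; rewrite inE => /andP[iJ iv].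
by exists i.
Qed.

Lemma extends_deg A B J v : extends A B -> deg A J v <= deg B J v.
Proof.
move=> AB; apply: subset_leq_card; apply/subsetP => i; rewrite !inE => /andP[-> /=].
by case E: (A i v) => [b|//] _; rewrite (AB _ _ _ E).
Qed.

Lemma extends_occ A B J X : extends A B -> occ A J X -> occ B J X.
Proof.
move=> AB oA v /oA [i iJ]; case E: (A i v) => [b|//] _; exists i => //.
by rewrite (AB _ _ _ E).
Qed.

(** Flip [v] in an assignment critical for row [i]: row [i] becomes true, so another row turns
    false, and that row must contain the opposite literal. *)
Lemma mu_polarity A J X i v b : mu A J X -> i \in J -> v \in X ->
  A i v = Some b -> exists2 j, j \in J & A j v = Some (~~ b).
Proof.
move=> /muP [U M] iJ vX iv; have [f /criticalP [fi fu]] := M i iJ.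
have fv : f v = ~~ b.
  by move/falsifiedP: fi => /(_ v vX); rewrite iv; case: (f v) b {iv} => [] [].
have [j jJ /falsifiedP jf] := U (upd f v b).
exists j => //; case: (eqVneq (A j v) (Some (f v))) => [->|Ajv]; first by rewrite fv.
have ji : j = i.
  apply: fu => //; apply/falsifiedP => w wX; case: (eqVneq w v) => [->//|wv].
  by have := jf w wX; rewrite updE (negPf wv).
by have := jf v vX; rewrite updE eqxx ji iv eqxx.
Qed.

Lemma mu_ldeg_gt0 A J X v b : mu A J X -> occ A J X -> v \in X -> 0 < ldeg A J v b.
Proof.
move=> M O vX; have [i iJ] := O v vX; case E: (A i v) => [c|//] _.
rewrite card_gt0; apply/set0Pn; have [cb|cb] := eqVneq c b.
  by exists i; rewrite inE iJ E cb eqxx.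
have [j jJ jv] := mu_polarity M iJ vX E.
by exists j; rewrite inE jJ jv; move: cb; case: c b {E jv} => [] [].
Qed.

(** * Saturation and the effect of setting a literal *)

Definition fill A i0 v0 b0 : I -> V -> option bool :=
  fun i v => if (i == i0) && (v == v0) then Some b0 else A i v.

(* A maximal extension has the saturation property: if [fill A i v b] is no
   longer unsatisfiable, any model of it is critical for [i] and sets [v] to [b]. *)
Lemma mu_saturate A J X : mu A J X ->
  exists2 B, extends A B & mu B J X /\ saturated B J X.
Proof.
pose free A := [set p : I * V | [&& p.1 \in J, p.2 \in X & A p.1 p.2 == None]].
have [n] := ubnP #|free A|; elim: n A => // n IHn A ltn M.
case: (boolP [exists i in J, [exists v in X, [exists b,
    (A i v == None) && unsat (fill A i v b) J X]]]) => [|noext].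
  case/exists_inP=> i iJ /exists_inP [v vX] /existsP [b /andP[/eqP Aiv U]].
  have AF : extends A (fill A i v b).
    move=> j w c; rewrite /fill; case: ifP => // /andP[/eqP-> /eqP->].
    by rewrite Aiv.
  have MF : mu (fill A i v b) J X.
    apply/muP; split; first exact/unsatP.
    move=> j jJ; have [f /criticalP [jf fu]] := (muP _ _ _ M).2 j jJ.
    have sub k : falsified (fill A i v b) X f k -> falsified A X f k.
      move=> /falsifiedP kf; apply/falsifiedP => w wX; apply/negP => /eqP /AF E.
      by have := kf w wX; rewrite E eqxx.
    have [k kJ kf] := (unsatP _ _ _ U) f.
    have kj : k = j by apply: fu => //; apply: sub.
    exists f; apply/criticalP; split; first by rewrite -kj.
    by move=> m mJ /sub; apply: fu.
  have lt : #|free (fill A i v b)| < n.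
    rewrite ltnS in ltn; apply: leq_trans ltn; apply: proper_card.
    apply/properP; split.
      apply/subsetP => -[j w]; rewrite !inE /= /fill.
      by case: ifP => [_|_ //]; rewrite !andbF.
    exists (i, v); rewrite !inE /= iJ vX ?Aiv //=.
    by rewrite /fill !eqxx.
  have [B FB MB] := IHn _ lt MF; exists B => // j w c /AF; exact: FB.
exists A => //; split=> // i v b iJ vX Aiv.
case E: (A i v) => [c|].
  have [f fi] := (muP _ _ _ M).2 i iJ; exists f => //.
  case/criticalP: fi => /falsifiedP /(_ v vX) + _; rewrite E; move: Aiv; rewrite E.
  by case: (f v) c b {E} => [] [] [].
have : ~~ unsat (fill A i v b) J X.
  apply: contra noext => U; apply/exists_inP; exists i => //.
  by apply/exists_inP; exists v => //; apply/existsP; exists b; rewrite E eqxx.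
rewrite negb_forall => /existsP [f] /exists_inPn nof.
have eqf j : j != i -> falsified (fill A i v b) X f j = falsified A X f j.
  by move=> ji; apply: eq_forallb_in => w _; rewrite /fill (negPf ji).
have fu j : j \in J -> falsified A X f j -> j = i.
  move=> jJ jf; apply/eqP; apply: contraTT (nof j jJ) => ji.
  by rewrite eqf // jf.
have fi : falsified A X f i.
  by have [j jJ jf] := (muP _ _ _ M).1 f; rewrite -(fu j).
exists f; first exact/criticalP.
have := nof i iJ; rewrite negb_forall_in => /exists_inP [w wX].
rewrite negbK /fill eqxx /=; case: (eqVneq w v) => [->|_ /eqP Aiw].
  by move=> /eqP[].
by have := falsifiedP _ _ _ _ fi w wX; rewrite Aiw eqxx.
Qed.

Definition assign A J v b := [set i in J | A i v != Some b].

Lemma card_assign A J v b : #|J| = #|assign A J v b| + ldeg A J v b.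
Proof.
rewrite addnC -(cardsID [set i | A i v == Some b]) /ldeg; congr (_ + _).
  by apply: eq_card => i; rewrite !inE.
by apply: eq_card => i; rewrite !inE andbC.
Qed.

(** Saturation provides, for each remaining row, a critical assignment that gives [v] the value [b];
    it stays critical after the deletion. *)
Lemma mu_assign A J X v b : mu A J X -> saturated A J X -> v \in X ->
  mu A (assign A J v b) (X :\ v).
Proof.
move=> /muP [U M] S vX; apply/muP; split=> [f|i].
  have [i iJ /falsifiedP fi] := U (upd f v b); exists i.
    by rewrite inE iJ; have := fi v vX; rewrite updE eqxx.
  apply/falsifiedP => w; rewrite !inE => /andP[wv wX].
  by have := fi w wX; rewrite updE (negPf wv).
rewrite inE => /andP[iJ iv]; have [f /criticalP [fi fu] fv] := S i v b iJ vX iv.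
exists f; apply/criticalP; split=> [|j].
  by apply/falsifiedP => w; rewrite !inE => /andP[_]; apply: (falsifiedP _ _ _ _ fi).
rewrite inE => /andP[jJ jv] /falsifiedP jf; apply: fu => //.
apply/falsifiedP => w wX; have [->|wv] := eqVneq w v; first by rewrite fv.
by apply: jf; rewrite !inE wv.
Qed.

Lemma mu_shrink A J X (Y : {set V}) : Y \subset X ->
  (forall i v, i \in J -> v \in X :\: Y -> A i v = None) -> mu A J X -> mu A J Y.
Proof.
move=> YX N /muP [U M].
have eqf f i : i \in J -> falsified A Y f i = falsified A X f i.
  move=> iJ; apply/falsifiedP/falsifiedP => H v vX.
    have [/H //|vY] := boolP (v \in Y); rewrite N // inE vY; exact: vX.
  by apply: H; apply: (subsetP YX).
apply/muP; split=> [f|i iJ].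
  by have [i iJ fi] := U f; exists i => //; rewrite eqf.
have [f /criticalP [fi fu]] := M i iJ; exists f; apply/criticalP; split.
  by rewrite eqf.
by move=> j jJ; rewrite eqf //; apply: fu.
Qed.

Lemma deg_assign A J v b w : deg A J w <= deg A (assign A J v b) w + ldeg A J v b.
Proof.
rewrite /deg /ldeg (leq_trans _ (leq_card_setU _ _).1) //.
apply: subset_leq_card; apply/subsetP => i; rewrite !inE => /andP[-> ->] /=.
by case: eqP.
Qed.

Lemma deg_le_card A J v : deg A J v <= #|J|.
Proof. by apply: subset_leq_card; apply/subsetP => i; rewrite inE => /andP[]. Qed.

Lemma occ_assign A J X v b : (forall w, w \in X :\ v -> ldeg A J v b < deg A J w) ->
  occ A (assign A J v b) (X :\ v).
Proof.
move=> H; apply: occ_deg => w wX; have := H w wX; have := deg_assign A J v b w.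
card_lia.
Qed.

(** * Variables of minimal degree and Tarsi's inequality *)

Lemma min_deg_exists A J X : X != set0 ->
  exists2 v, v \in X & forall w, w \in X -> deg A J v <= deg A J w.
Proof.
case/set0Pn=> v0 v0X; case: (@arg_minnP _ v0 (mem X) (deg A J) v0X) => v vX H.
by exists v.
Qed.

(** Both signs of [v] occur, so fewer rows are deleted than [v] has occurrences, and by minimality
    no other variable loses all of its own. *)
Lemma occ_assign_min A J X v b : mu A J X -> occ A J X -> v \in X ->
  (forall w, w \in X -> deg A J v <= deg A J w) -> occ A (assign A J v b) (X :\ v).
Proof.
move=> M O vX H; apply: occ_assign => w; rewrite !inE => /andP[_ wX].
apply: leq_trans (H w wX); rewrite (deg_ldeg A J v b) -[X in X < _]addn0 ltn_add2l.
exact: mu_ldeg_gt0 M O vX.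
Qed.

Lemma mu_nonempty A J X : mu A J X -> 0 < #|J|.
Proof.
move=> /muP [/(_ [ffun => true]) [i iJ _] _].
by rewrite card_gt0; apply/set0Pn; exists i.
Qed.

(** Induction on the variables: after saturation, setting one of minimal degree deletes at least one
    row and exactly one variable. *)
Lemma tarsi A J X : mu A J X -> occ A J X -> #|X| < #|J|.
Proof.
have [n] := ubnP #|X|; elim: n A J X => // n IHn A J X ltn M O.
have [->|X0] := eqVneq X set0; first by rewrite cards0; apply: mu_nonempty M.
have [B AB [MB SB]] := mu_saturate M; have OB := extends_occ AB O.
have [v vX vmin] := min_deg_exists B J X0.
have cX := cardsD1 v X; rewrite vX /= in cX; have lt : #|X :\ v| < n by card_lia.
have := IHn _ _ _ lt (mu_assign true MB SB vX) (occ_assign_min true MB OB vX vmin).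
have := mu_ldeg_gt0 true MB OB vX; have := card_assign B J v true; card_lia.
Qed.

Lemma min_ldeg_bound A J X v b : mu A J X -> saturated A J X -> occ A J X ->
  v \in X -> (forall w, w \in X -> deg A J v <= deg A J w) ->
  ldeg A J v b + #|X| <= #|J|.
Proof.
move=> M S O vX vmin.
have := tarsi (mu_assign b M S vX) (occ_assign_min b M O vX vmin).
have := card_assign A J v b; have := cardsD1 v X; rewrite vX /=; card_lia.
Qed.

(** In a saturated extension each sign of a variable of minimal degree occurs at most [k] times, and
    extending only raises degrees. *)
Lemma low_deg_exists A J X k : mu A J X -> occ A J X -> X != set0 ->
  #|J| <= #|X| + k -> exists2 v, v \in X & deg A J v <= k.*2.
Proof.
move=> M O X0 Jk; have [B AB [MB SB]] := mu_saturate M.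
have OB := extends_occ AB O; have [v vX vmin] := min_deg_exists B J X0.
exists v => //; apply: leq_trans (extends_deg J v AB) _; rewrite card_deg.
have := min_ldeg_bound true MB SB OB vX vmin.
have := min_ldeg_bound false MB SB OB vX vmin; card_lia.
Qed.

(** * Subsets of variables confined to few clauses *)

Definition only_in A J D Z :=
  forall i z, i \in J -> z \in Z -> A i z != None -> i \in D.

Lemma unsat_minimal A J X : unsat A J X -> exists2 D : {set I}, D \subset J & mu A D X.
Proof.
move=> /(@minset_exists _ (fun D : {set I} => unsat A D X)) [D /minsetP [U M] DJ].
exists D => //; apply/muP; split=> [|i iD]; first exact/unsatP.
have nU : ~~ unsat A (D :\ i) X.
  apply/negP => /M /(_ (subsetDl _ _)) E.
  by move: iD; rewrite -E !inE eqxx.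
move: nU; rewrite negb_forall => /existsP [f] /exists_inPn nof; exists f.
have fu j : j \in D -> falsified A X f j -> j = i.
  move=> jD jf; apply/eqP; apply: contraLR jf => ji.
  by apply: nof; rewrite !inE ji.
by apply/criticalP; split=> //; have [j jD jf] := (unsatP _ _ _ U) f; rewrite -(fu j).
Qed.

(* Restrict to the rows of [D] not satisfied, outside [Z], by an assignment
   critical for a row of [D]; on [Z] they are unsatisfiable. *)
Lemma mu_confined A J X D Z : mu A J X -> Z \subset X -> D \subset J ->
  only_in A J D Z -> D != set0 -> exists2 D' : {set I}, D' \subset D & mu A D' Z.
Proof.
move=> /muP [U M] ZX DJ DZ /set0Pn [i iD].
have [f /criticalP [fi fu]] := M i (subsetP DJ _ iD).
pose D1 := [set j in D | falsified A (X :\: Z) f j].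
have [|D' D'D1 MD'] := @unsat_minimal A D1 Z; last first.
  exists D' => //; apply: subset_trans D'D1 _.
  by apply/subsetP => j; rewrite inE => /andP[].
apply/unsatP => g; pose h : {ffun V -> bool} := [ffun v => if v \in Z then g v else f v].
have [j jJ /falsifiedP jh] := U h.
have jZ : falsified A Z g j.
  apply/falsifiedP => v vZ; have := jh v (subsetP ZX _ vZ).
  by rewrite ffunE vZ.
have jXZ : falsified A (X :\: Z) f j.
  apply/falsifiedP => v; rewrite inE => /andP[vZ vX]; have := jh v vX.
  by rewrite ffunE (negPf vZ).
exists j => //; rewrite inE jXZ andbT.
case: (boolP (j \in D)) => // jD; rewrite -(fu j jJ) // in iD; first by rewrite iD in jD.
apply/falsifiedP => v vX; have [vZ|vZ] := boolP (v \in Z).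
  case E: (A j v) => [b|//]; case/negP: jD; apply: (DZ j v) => //.
  by rewrite E.
by apply: (falsifiedP _ _ _ _ jXZ); rewrite inE vZ.
Qed.

Definition occurring A J X := [set v in X | [exists i in J, A i v != None]].

Lemma mu_occurring A J X : mu A J X -> mu A J (occurring A J X).
Proof.
apply: mu_shrink; first by apply/subsetP => v; rewrite inE => /andP[].
move=> i v iJ; rewrite !inE negb_and => /andP[/orP[/negPf->//|]] /exists_inPn N _.
by apply/eqP; rewrite -[_ == _]negbK; apply: N.
Qed.

Lemma occ_occurring A J X : occ A J (occurring A J X).
Proof. by move=> v; rewrite inE => /andP[_ /exists_inP]. Qed.

(** Some part [D'] of [D] is minimally unsatisfiable over [Z]; the variables it misses are confined
    to the rest of [D], so Tarsi's inequality can be summed over successive parts. An excess of one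
    leaves room for a single part, which is all of [D]. *)
Lemma confined_card_full A J X D Z : mu A J X -> occ A J X -> Z \subset X ->
  D \subset J -> only_in A J D Z -> Z != set0 ->
  #|Z| < #|D| /\ (#|D| <= #|Z|.+1 -> mu A D Z).
Proof.
move=> M O ZX; have [n] := ubnP #|D|; elim: n D Z ZX => // n IHn D Z ZX ltn DJ DZ Z0.
have D0 : D != set0.
  case/set0Pn: Z0 => z zZ; have [i iJ iz] := O z (subsetP ZX _ zZ).
  by apply/set0Pn; exists i; apply: (DZ i z).
have [D' D'D M'] := mu_confined M ZX DJ DZ D0.
pose Z' := occurring A D' Z; have Z'Z : Z' \subset Z.
  by apply/subsetP => v; rewrite inE => /andP[].
have lt' : #|Z'| < #|D'| := tarsi (mu_occurring M') (@occ_occurring _ _ _).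
have cD := cardsID D' D; rewrite (setIidPr D'D) in cD.
have cZ := cardsID Z' Z; rewrite (setIidPr Z'Z) in cZ.
have [Z2|Z2] := eqVneq (Z :\: Z') set0.
  rewrite Z2 cards0 in cZ; split=> [|le]; first card_lia.
  have -> : D = D' by apply/esym/eqP; rewrite eqEcard D'D; card_lia.
  exact: M'.
(* The rest contributes an excess of its own, so the premise of the second claim fails. *)
have [||||lt2 _] := IHn (D :\: D') (Z :\: Z') _ _ _ _ Z2.
- by apply: subset_trans ZX; apply: subsetDl.
- by have := mu_nonempty M'; card_lia.
- by apply: subset_trans DJ; apply: subsetDl.
- move=> i z iJ; rewrite !inE => /andP[zZ' zZ] Aiz; rewrite (DZ i z) // andbT.
  apply: contra zZ' => iD'; rewrite zZ; apply/exists_inP; by exists i.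
by split; card_lia.
Qed.

Lemma confined_card A J X D Z : mu A J X -> occ A J X -> Z \subset X ->
  D \subset J -> only_in A J D Z -> Z != set0 -> #|Z| < #|D|.
Proof. by move=> M O ZX DJ DZ Z0; case: (confined_card_full M O ZX DJ DZ Z0). Qed.

Lemma deg_only_in A J D Z z : D \subset J -> only_in A J D Z -> z \in Z ->
  deg A J z = deg A D z.
Proof.
move=> DJ DZ zZ; apply: eq_card => i; rewrite !inE.
case E: (_ != None); rewrite ?andbF // !andbT.
by apply/idP/idP => [iJ|/(subsetP DJ) //]; apply: (DZ i z).
Qed.

Lemma confined_low_deg A J X D Z : mu A J X -> occ A J X -> Z \subset X ->
  D \subset J -> only_in A J D Z -> Z != set0 -> #|D| <= #|Z|.+1 ->
  exists2 z, z \in Z & deg A J z <= 2.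
Proof.
move=> M O ZX DJ DZ Z0 le; have [_ /(_ le) MD] := confined_card_full M O ZX DJ DZ Z0.
have OD : occ A D Z.
  move=> z zZ; have [i iJ iz] := O z (subsetP ZX _ zZ).
  by exists i => //; apply: (DZ i z).
have [|z zZ dz] := low_deg_exists MD OD Z0 (k := 1); first by rewrite addn1.
by exists z => //; rewrite (deg_only_in DJ DZ).
Qed.

(** * Resolution on a variable of degree two *)

Definition resolve A i j : I -> V -> option bool :=
  fun k v => if k == i then (if A i v is Some b then Some b else A j v) else A k v.

(** Row [i] becomes the union of both rows. Outside [v] the two do not clash, so the merged row is
    falsified exactly when both are falsified there; this carries over unsatisfiability and critical
    assignments. *)
Lemma mu_resolve A J X v i j b0 : mu A J X -> v \in X -> i \in J -> j \in J ->
  A i v = Some b0 -> A j v = Some (~~ b0) ->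
  (forall k, k \in J -> A k v != None -> k = i \/ k = j) ->
  mu (resolve A i j) (J :\ j) (X :\ v).
Proof.
move=> /muP [U M] vX iJ jJ Ai Aj only.
have ij : i != j by apply: contra_eq_neq Ai => ->; rewrite Aj; case: (b0).
have neq_b0 : (Some b0 != Some (~~ b0)) * (Some (~~ b0) != Some b0) by case: (b0).
have iX f : f v = ~~ b0 -> falsified A X f i = falsified A (X :\ v) f i.
  move=> fv; apply/falsifiedP/falsifiedP => H w.
    by rewrite !inE => /andP[_]; apply: H.
  by move=> wX; case: (eqVneq w v) => [->|wv]; rewrite ?Ai ?Aj ?fv ?neq_b0 // H ?inE ?wv.
have jX f : f v = b0 -> falsified A X f j = falsified A (X :\ v) f j.
  move=> fv; apply/falsifiedP/falsifiedP => H w.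
    by rewrite !inE => /andP[_]; apply: H.
  by move=> wX; case: (eqVneq w v) => [->|wv]; rewrite ?Ai ?Aj ?fv ?neq_b0 // H ?inE ?wv.
have kX f k : k \in J -> k != i -> k != j ->
    falsified A X f k = falsified A (X :\ v) f k.
  move=> kJ ki kj; apply/falsifiedP/falsifiedP => H w.
    by rewrite !inE => /andP[_]; apply: H.
  move=> wX; case: (eqVneq w v) => [->|wv]; last by rewrite H ?inE ?wv.
  case E: (A k v) => [b|//]; case: (only k kJ); rewrite ?E // => Ek.
    by rewrite Ek eqxx in ki.
  by rewrite Ek eqxx in kj.
have updX f b k : falsified A (X :\ v) (upd f v b) k = falsified A (X :\ v) f k.
  by apply: eq_forallb_in => w; rewrite !inE => /andP[wv _]; rewrite updE (negPf wv).
have updv f b : upd f v b v = b by rewrite updE eqxx.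
have resX f k : k != i ->
    falsified (resolve A i j) (X :\ v) f k = falsified A (X :\ v) f k.
  by move=> ki; apply: eq_forallb_in => w _; rewrite /resolve (negPf ki).
have resi f : falsified A (X :\ v) f i -> falsified A (X :\ v) f j ->
    falsified (resolve A i j) (X :\ v) f i.
  move=> /falsifiedP fi /falsifiedP fj; apply/falsifiedP => w wX.
  by rewrite /resolve eqxx; have := fi w wX; case: (A i w) => // _; apply: fj.
have updid f b : f v = b -> upd f v b = f.
  by move=> fv; apply/ffunP => w; rewrite updE; case: eqP => [->|].
(* Setting [v] to [b0] satisfies [i]; a third row does not contain [v] and would already be
   falsified by [f], so the falsified row is [j]. *)
have crit f : critical A J X f i ->
    falsified A (X :\ v) f i /\ falsified A (X :\ v) f j.
  case/criticalP => fi fu; split.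
    by apply/falsifiedP => w; rewrite !inE => /andP[_]; apply: (falsifiedP _ _ _ _ fi).
  have [m mJ mf] := U (upd f v b0).
  have mi : m != i.
    apply/eqP => E; have := falsifiedP _ _ _ _ mf v vX.
    by rewrite E Ai updv eqxx.
  have [E|mj] := eqVneq m j; first by move: mf; rewrite E jX // updX.
  move: mf; rewrite kX // updX -kX // => /(fu m mJ) E.
  by rewrite E eqxx in mi.
(* One assignment falsifies both rows outside [v], so the precedence of row [i] in [resolve] loses
   nothing. *)
have [f0 /crit [f0i f0j]] := M i iJ.
have noclash w b c : w \in X :\ v -> A i w = Some b -> A j w = Some c -> b = c.
  move=> wX Eb Ec; have := falsifiedP _ _ _ _ f0i w wX.
  have := falsifiedP _ _ _ _ f0j w wX; rewrite Eb Ec.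
  by case: (f0 w) b c {Eb Ec} => [] [] [].
apply/muP; split=> [f|k]; last first.
  rewrite !inE => /andP[kj kJ]; have [E|ki] := eqVneq k i.
    subst k; have [f fc] := M i iJ; have [fi fj] := crit f fc.
    case/criticalP: fc => _ fu; exists f; apply/criticalP.
    split=> [|m]; first exact: resi.
    rewrite !inE => /andP[mj mJ]; have [//|mi] := eqVneq m i.
    by rewrite resX // -kX //; apply: fu.
  have [f /criticalP [kf fu]] := M k kJ; exists f; apply/criticalP.
  split; first by rewrite resX // -kX.
  move=> m; rewrite !inE => /andP[mj mJ].
  have [->|mi] := eqVneq m i; last by rewrite resX // -kX //; apply: fu.
  move=> /falsifiedP fr; have [fv|fv] := eqVneq (f v) b0.
    case/eqP: kj; apply/esym; apply: fu => //; rewrite jX //; apply/falsifiedP => w wX.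
    have := fr w wX; rewrite /resolve eqxx; case Ei: (A i w) => [b|//].
    by case Ej: (A j w) => [c|//]; rewrite (noclash _ _ _ wX Ei Ej).
  apply: fu => //; rewrite iX; last by move: fv; case: (f v) (b0) => [] [].
  apply/falsifiedP => w wX.
  by have := fr w wX; rewrite /resolve eqxx; case: (A i w).
(* The value [~~ b0] satisfies [j] and [b0] satisfies [i]: either a third row is falsified, or both
   [i] and [j] are falsified outside [v]. *)
have [m mJ] := U (upd f v (~~ b0)); have [E|mj] := eqVneq m j.
  by move=> /falsifiedP /(_ v vX); rewrite E Aj updv eqxx.
have [E|mi] := eqVneq m i; last first.
  by rewrite kX // updX => mf; exists m; rewrite ?inE ?mj // resX.
rewrite {}E iX // updX => fi.
have [k kJ] := U (upd f v b0); have [E|ki] := eqVneq k i.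
  by move=> /falsifiedP /(_ v vX); rewrite E Ai updv eqxx.
have [E|kj] := eqVneq k j; last first.
  by rewrite kX // updX => kf; exists k; rewrite ?inE ?kj // resX.
rewrite {}E jX // updX => fj.
by exists i; rewrite ?inE ?ij //; apply: resi.
Qed.

Lemma deg2_rows A J X v : mu A J X -> occ A J X -> v \in X -> deg A J v <= 2 ->
  exists i j, [/\ i \in J, j \in J, A i v = Some true, A j v = Some false &
    forall k, k \in J -> A k v != None -> k = i \/ k = j].
Proof.
move=> M O vX d2.
have /card_gt0P [i] := mu_ldeg_gt0 true M O vX; rewrite inE => /andP[iJ /eqP Ai].
have /card_gt0P [j] := mu_ldeg_gt0 false M O vX; rewrite inE => /andP[jJ /eqP Aj].
exists i, j; split=> // k kJ Ak.
have ij : i != j by apply: contra_eq_neq Ai => ->; rewrite Aj.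
have /eqP E : [set i; j] == [set k in J | A k v != None].
  rewrite eqEcard cards2 ij d2 andbT; apply/subsetP => m.
  by rewrite !inE => /orP[] /eqP ->; rewrite ?iJ ?jJ ?Ai ?Aj.
have : k \in [set i; j] by rewrite E inE kJ.
by rewrite !inE => /orP[] /eqP; [left|right].
Qed.

Lemma resolve_None A i j k v : A k v != None -> resolve A i j k v != None.
Proof. by rewrite /resolve; case: (eqVneq k i) => [->|_ //]; case: (A i v). Qed.

Lemma deg_resolve A J i j v :
  deg A J v <= deg (resolve A i j) (J :\ j) v + (A j v != None).
Proof.
rewrite /deg; have [Aj|Aj] := eqVneq (A j v) None.
  rewrite addn0; apply: subset_leq_card; apply/subsetP => k.
  rewrite !inE => /andP[kJ Ak]; have kj : k != j by apply: contraNneq Ak => ->; rewrite Aj.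
  by rewrite kJ kj resolve_None.
rewrite (cardsD1 j) addnC leq_add ?leq_b1 //.
  apply: subset_leq_card; apply/subsetP => k; rewrite !inE => /and3P[kj kJ Ak].
  by rewrite kJ kj resolve_None.
Qed.

Lemma occ_resolve A J X v i j : i \in J -> i != j -> occ A J X ->
  occ (resolve A i j) (J :\ j) (X :\ v).
Proof.
move=> iJ ij O w; rewrite !inE => /andP[_ /O [k kJ Ak]].
have [E|kj] := eqVneq k j; last by exists k; rewrite ?inE ?kj // resolve_None.
by exists i; rewrite ?inE ?ij // /resolve eqxx -E; case: (A i w).
Qed.

(* Eliminate a variable occurring once in each sign: merging its two rows
   preserves the deficiency and removes at most one row of [D]. *)
Lemma delta1_confined A J X D Z p : mu A J X -> occ A J X -> #|J| = #|X|.+1 ->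
  Z \subset X -> D \subset J -> only_in A J D Z -> Z != set0 -> 0 < p ->
  #|D| <= #|Z| + p -> exists2 z, z \in Z & deg A J z <= p.+1.
Proof.
have [n] := ubnP #|X|; elim: n A J X D p => // n IHn A J X D p ltn M O JX ZX DJ DZ Z0 p0 DZp.
have X0 : X != set0 by apply: contraNneq Z0 => E; rewrite -subset0 -E.
have [|v vX dv] := low_deg_exists M O X0 (k := 1); first by rewrite addn1 JX.
(* The dropped row [j] is chosen outside [D] unless both rows lie in [D]; thus the merged row
   belongs to [D] whenever one of the two does. *)
have [b [i [j [iJ jJ Ai Aj [only ijD]]]]] : exists b i j,
    [/\ i \in J, j \in J, A i v = Some b, A j v = Some (~~ b) &
     (forall k, k \in J -> A k v != None -> k = i \/ k = j) /\ (j \in D -> i \in D)].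
  have [i [j [iJ jJ Ai Aj only]]] := deg2_rows M O vX dv.
  case: (boolP (i \in D)) => iD; first by exists true, i, j.
  exists false, j, i; split=> //; split=> [k kJ /only [//||]|]; try by [right|left].
  by move=> iD'; rewrite iD' in iD.
have ij : i != j by apply: contra_eq_neq Ai => ->; rewrite Aj; case: (b).
set B := resolve A i j.
have MB : mu B (J :\ j) (X :\ v) := mu_resolve M vX iJ jJ Ai Aj only.
have OB : occ B (J :\ j) (X :\ v) by apply: occ_resolve.
have cX := cardsD1 v X; rewrite vX /= in cX.
have cJ := cardsD1 j J; rewrite jJ /= in cJ.
have cD := cardsD1 j D.
have [vZ|vZ] := boolP (v \in Z); first by exists v => //; card_lia.
have ZXv : Z \subset X :\ v.
  by apply/subsetP => z zZ; rewrite !inE (subsetP ZX) // andbT; apply: contraNneq vZ => <-.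
have DJj : D :\ j \subset J :\ j by apply: setSD.
have DZB : only_in B (J :\ j) (D :\ j) Z.
  move=> k z; rewrite !inE => /andP[kj kJ] zZ; rewrite kj /B /resolve.
  case: (eqVneq k i) => [->|_] Ak; last exact: (DZ k z).
  case E: (A i z) Ak => [c|] Ak; first by apply: (DZ i z); rewrite ?E.
  by apply: ijD; apply: (DZ j z).
have [jD|jD] := boolP (j \in D); last first.
  rewrite (negPf jD) /= in cD.
  have [|||z zZ dz] := IHn B _ _ _ p _ MB OB _ ZXv DJj DZB Z0 p0; try card_lia.
  exists z => //; apply: leq_trans (deg_resolve A J i j z) _.
  have -> : A j z = None; last by rewrite addn0.
  by apply/eqP; apply: contraNT jD => Aj'; apply: (DZ j z).
(* [D] loses a row, so the allowance falls to [p.-1]; [confined_card] keeps it positive, and the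
   merge costs [z] at most one occurrence. *)
rewrite jD /= in cD; have lt := confined_card MB OB ZXv DJj DZB Z0.
have [||||z zZ dz] := IHn B _ _ _ p.-1 _ MB OB _ ZXv DJj DZB Z0; try card_lia.
exists z => //; apply: leq_trans (deg_resolve A J i j z) _.
have := leq_b1 (A j z != None); rewrite -/B; card_lia.
Qed.

(** * Deficiency 2 *)

Lemma deg_assign_confined A J X v b z : mu A J X -> occ A J X -> z \in X ->
  z \notin occurring A (assign A J v b) (X :\ v) -> z != v ->
  forall i, i \in J -> A i z != None -> A i v = Some b.
Proof.
move=> M O zX; rewrite !inE => + zv; rewrite zv zX /= => /exists_inPn H i iJ iz.
by apply: contraTeq iz => iv; apply: H; rewrite inE iJ.
Qed.

(* Setting [z] to [c] makes the set [Zc c] of variables disappear. Counting gives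
   [#|Zc c| >= ldeg z c - 2], and equality for [~~ b]; so setting [z] to [~~ b]
   leaves deficiency 1, where [Zc b] is confined to too few clauses. *)
Lemma delta2_nonsingular A J X z b : mu A J X -> saturated A J X -> occ A J X ->
  #|J| = #|X| + 2 -> (forall v, v \in X -> 4 <= deg A J v) -> z \in X ->
  3 <= ldeg A J z b -> 2 <= ldeg A J z (~~ b) -> False.
Proof.
move=> M S O JX d4 zX k3 p2.
pose Jk c := [set i in J | A i z == Some c].
pose Zc c := (X :\ z) :\: occurring A (assign A J z c) (X :\ z).
have JkJ c : Jk c \subset J by apply/subsetP => i; rewrite inE => /andP[].
have ZX c : Zc c \subset X by apply/subsetP => v; rewrite !inE => /and3P[].
have ZJ c : only_in A J (Jk c) (Zc c).
  move=> i v iJ vZ iv; rewrite inE iJ /=; apply/eqP.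
  move: vZ; rewrite inE [v \in X :\ z]inE inE => /and3P[vS vz vX].
  exact: (deg_assign_confined M O vX vS vz).
have cX := cardsD1 z X; rewrite zX /= in cX.
have cZ c : #|occurring A (assign A J z c) (X :\ z)| + #|Zc c| = #|X :\ z|.
  rewrite -(cardsID (occurring A (assign A J z c) (X :\ z)) (X :\ z)) (setIidPr _) //.
  by apply/subsetP => v; rewrite inE => /andP[].
have MS c := mu_occurring (mu_assign c M S zX).
have tZ c : ldeg A J z c <= #|Zc c| + 2.
  have := tarsi (MS c) (@occ_occurring _ _ _).
  have := card_assign A J z c; have := cZ c; card_lia.
have eZ c : Zc c != set0 -> #|Zc c| + 2 <= ldeg A J z c.
  move=> Z0; rewrite leqNgt; apply/negP => lt.
  have [|v vZ dv] := confined_low_deg M O (ZX c) (JkJ c) (@ZJ c) Z0.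
    by rewrite -/(ldeg _ _ _ _); card_lia.
  by have := d4 v (subsetP (ZX c) _ vZ); card_lia.
have e1 : #|Zc (~~ b)| + 2 = ldeg A J z (~~ b).
  apply/eqP; rewrite eqn_leq tZ andbT.
  by have [->|/eZ //] := eqVneq (Zc (~~ b)) set0; rewrite cards0.
have Z0 : Zc b != set0 by rewrite -card_gt0; have := tZ b; card_lia.
have sub : Zc b \subset occurring A (assign A J z (~~ b)) (X :\ z).
  apply/subsetP => v vZ; have vX := subsetP (ZX b) _ vZ.
  have [i iJ iv] := O v vX; have := ZJ b i v iJ vZ iv; rewrite inE iJ /= => /eqP iz.
  move: vZ; rewrite inE => /andP[_ vXz]; rewrite inE vXz; apply/exists_inP.
  by exists i => //; rewrite inE iJ iz; case: (b).
have subJ : Jk b \subset assign A J z (~~ b).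
  by apply/subsetP => i; rewrite !inE => /andP[-> /eqP->]; case: (b).
have onl : only_in A (assign A J z (~~ b)) (Jk b) (Zc b).
  by move=> i v; rewrite inE => /andP[iJ _]; apply: ZJ.
(* Allowance 2 yields a variable of degree at most 3, while all degrees are at least 4. *)
have [||v vZ dv] :=
  delta1_confined (MS (~~ b)) (@occ_occurring _ _ _) _ sub subJ onl Z0 (isT : 0 < 2).
- have := card_assign A J z (~~ b); have := cZ (~~ b); card_lia.
- exact: tZ.
have := d4 v (subsetP (ZX b) _ vZ).
by rewrite (deg_only_in (JkJ b) (@ZJ b) vZ) -(deg_only_in subJ onl vZ) leqNgt ltnS dv.
Qed.

(* If a literal occurs only in row [e], saturation forces every clash partner
   of [e] in it to contain the remaining literals of [e]. *)
Lemma saturated_singular A J X z b e i w c : mu A J X -> saturated A J X ->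
  z \in X -> w \in X -> w != z -> e \in J -> i \in J ->
  (forall j, j \in J -> A j z = Some b -> j = e) -> A i z = Some (~~ b) ->
  A e w = Some c -> A i w = Some c.
Proof.
move=> /muP [U M] S zX wX wz eJ iJ only Ai Ae; apply/eqP; apply: contraT => Aiw.
(* Flipping [z] in this [f] would falsify no row: not [e], where the literal on [w] is true, not
   [i], where the one on [z] becomes true, and no other, since [f] falsifies only [i]. *)
have [f /criticalP [/falsifiedP fi fu] fw] := S i w c iJ wX Aiw.
have fz : f z = b by have := fi z zX; rewrite Ai; case: (f z) (b) => [] [].
have [j jJ /falsifiedP jf] := U (upd f z (~~ b)).
have [/(only j jJ) E|Ajz] := eqVneq (A j z) (Some b).
  by have := jf w wX; rewrite E Ae updE (negPf wz) fw eqxx.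
have ji : j = i.
  apply: fu => //; apply/falsifiedP => v vX; have := jf v vX; rewrite updE.
  by case: (eqVneq v z) => [->|//] _; rewrite fz.
by have := jf z zX; rewrite ji Ai updE eqxx eqxx.
Qed.

Definition width A X i := #|[set v in X | A i v != None]|.

Lemma width_gt1 A X i v : 1 < width A X i ->
  exists2 w, w \in X & (w != v) && (A i w != None).
Proof.
rewrite /width (cardsD1 v); case: (_ \in _) => /=.
  rewrite add1n ltnS => /card_gt0P [w]; rewrite !inE => /and3P[wv wX iw].
  by exists w => //; rewrite wv.
rewrite add0n => /ltnW /card_gt0P [w]; rewrite !inE => /and3P[wv wX iw].
by exists w => //; rewrite wv.
Qed.

(* A variable violating the bound is singular; by [saturated_singular] another
   literal of its singular clause occurs even more often. *)
Lemma delta2_deg A J X : mu A J X -> saturated A J X -> #|J| = #|X| + 2 ->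
  (forall v, v \in X -> 4 <= deg A J v) -> (forall i, i \in J -> 1 < width A X i) ->
  forall v, v \in X -> deg A J v <= 4.
Proof.
move=> M S JX d4 wd; have O : occ A J X by apply: occ_deg => v /d4; card_lia.
have ns z b : z \in X -> 3 <= ldeg A J z b -> ldeg A J z (~~ b) = 1.
  move=> zX k3; apply/eqP; rewrite eqn_leq (mu_ldeg_gt0 (~~ b) M O zX) andbT leqNgt.
  by apply/negP; exact: (delta2_nonsingular M S O JX d4 zX k3).
have sing z b : z \in X -> 3 <= ldeg A J z b -> False.
  (* The number of occurrences rises strictly from literal to literal and cannot exceed [#|J|]. *)
  have [n] := ubnP (#|J| - ldeg A J z b); elim: n z b => // n IHn z b ltn zX k3.
  have /eqP /cards1P [e E] := ns z b zX k3.
  have : e \in [set i in J | A i z == Some (~~ b)] by rewrite E set11.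
  rewrite inE => /andP[eJ /eqP ez].
  have [w wX /andP[wz]] := width_gt1 z (wd e eJ); case Ew: (A e w) => [c|//] _.
  have sub : e |: [set i in J | A i z == Some b] \subset [set i in J | A i w == Some c].
    apply/subsetP => i; rewrite !inE => /orP[/eqP->|/andP[iJ /eqP iz]].
      by rewrite eJ Ew eqxx.
    rewrite iJ; apply/eqP; apply: (saturated_singular (b := ~~ b) M S zX wX wz eJ iJ _ _ Ew).
      move=> j jJ jz; apply/eqP; rewrite -in_set1 -E inE jJ jz; exact: eqxx.
    by rewrite negbK.
  have := subset_leq_card sub; rewrite cardsU1 inE ez andbC.
  have -> : (Some (~~ b) == Some b) = false by case: (b).
  rewrite /= -!/(ldeg _ _ _ _) add1n => lt.
  apply: (IHn w c) => //; last by card_lia.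
  have : ldeg A J w c <= #|J|.
    by apply: subset_leq_card; apply/subsetP => i; rewrite inE => /andP[].
  card_lia.
move=> v vX; have le2 b : ldeg A J v b <= 2 by rewrite leqNgt; apply/negP/sing.
by rewrite card_deg; have := le2 true; have := le2 false; card_lia.
Qed.

(** * Deficiency 6 *)

(* Flipping [u] in an assignment critical for a full row yields the full row of
   opposite sign at [u] that agrees with it elsewhere. *)
Lemma full_rows_ldeg A J X u b : mu A J X -> u \in X ->
  (forall i w, i \in J -> w \in X -> A i u != None -> A i w != None) ->
  ldeg A J u b <= ldeg A J u (~~ b).
Proof.
move=> /muP [U M] uX full.
pose R i j := [&& j \in J, A j u == Some (~~ b) & [forall w in X :\ u, A j w == A i w]].
have exR i : i \in J -> A i u = Some b -> exists j, R i j.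
  move=> iJ iu; have [f /criticalP [/falsifiedP fi fu]] := M i iJ.
  have fub : f u = ~~ b by have := fi u uX; rewrite iu; case: (f u) (b) => [] [].
  have [j jJ /falsifiedP jf] := U (upd f u b).
  have ju : A j u = Some (~~ b).
    case E: (A j u) => [c|].
      by have := jf u uX; rewrite E updE eqxx; case: (c) (b) => [] [].
    have ji : j = i.
      apply: fu => //; apply/falsifiedP => w wX; have := jf w wX; rewrite updE.
      by case: (eqVneq w u) => [->|//] _; rewrite E.
    by rewrite ji iu in E.
  exists j; rewrite /R jJ ju eqxx /=; apply/forall_inP => w.
  rewrite !inE => /andP[wu wX]; have := jf w wX; have := fi w wX.
  rewrite updE (negPf wu).
  have := full i w iJ wX; rewrite iu => /(_ isT); have := full j w jJ wX.
  rewrite ju => /(_ isT); case: (A i w) => [x|//]; case: (A j w) => [y|//] _ _.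
  by case: (f w) x y => [] [] [].
pose h i := odflt i [pick j | R i j].
have hR i : i \in [set i in J | A i u == Some b] -> R i (h i).
  rewrite inE => /andP[iJ /eqP iu]; rewrite /h; case: pickP => [//|nR].
  by have [j] := exR i iJ iu; rewrite nR.
(* Rows with a common partner agree on [X], so an assignment critical for one falsifies the
   other. *)
have inj : {in [set i in J | A i u == Some b] &, injective h}.
  move=> i k iS kS E; have := hR i iS; have := hR k kS; rewrite E.
  case/and3P=> _ _ /forall_inP Rk /and3P[_ _ /forall_inP Ri].
  move: iS kS; rewrite !inE => /andP[iJ /eqP iu] /andP[kJ /eqP ku].
  have [f /criticalP [/falsifiedP fi fu]] := M i iJ; apply/esym/fu => //.
  apply/falsifiedP => w wX; have [->|wu] := eqVneq w u.
    by rewrite ku -iu; apply: fi.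
  have wXu : w \in X :\ u by rewrite !inE wu.
  by rewrite -(eqP (Rk w wXu)) (eqP (Ri w wXu)); apply: fi.
rewrite /ldeg -(card_in_imset inj); apply: subset_leq_card.
by apply/subsetP => _ /imsetP [i iS ->]; case/and3P: (hR i iS) => jJ ju _; rewrite inE jJ.
Qed.

(** Each deleted row takes at most one occurrence of [z], so a drop by the full number of deleted
    rows puts [z] in all of them. *)
Lemma deg_assign_all A J v b z :
  deg A (assign A J v b) z + ldeg A J v b <= deg A J z ->
  forall i, i \in J -> A i v = Some b -> A i z != None.
Proof.
move=> le i iJ iv; apply: contraTN le => iz; rewrite -ltnNge /deg /ldeg.
rewrite -[X in _ < _ + X]prednK; last first.
  by rewrite card_gt0; apply/set0Pn; exists i; rewrite inE iJ iv eqxx.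
rewrite (cardsD1 i [set i in J | A i v == Some b]) inE iJ iv eqxx /= addnS ltnS.
rewrite (leq_trans _ (leq_card_setU _ _).1) //; apply: subset_leq_card.
apply/subsetP => k; rewrite !inE => /andP[kJ kz]; rewrite kJ kz /= andbT.
case: eqP => //= _; rewrite andbT; apply: contraNneq kz => ->; exact: iz.
Qed.

(** An assignment critical for [j] falsifies every row contained in [j]. *)
Lemma mu_row_eq A J X i j : mu A J X -> i \in J -> j \in J ->
  (forall w c, w \in X -> A i w = Some c -> A j w = Some c) -> i = j.
Proof.
move=> /muP [_ M] iJ jJ sub; have [f /criticalP [/falsifiedP fj fu]] := M j jJ.
apply: fu => //; apply/falsifiedP => w wX; apply/negP => /eqP /(sub w _ wX) E.
by have := fj w wX; rewrite E eqxx.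
Qed.

Lemma mu_width_gt0 A J X i : mu A J X -> 1 < #|J| -> i \in J -> 0 < width A X i.
Proof.
move=> M J1 iJ; rewrite card_gt0; apply/negP => /eqP w0.
have [j] : exists j, j \in J :\ i.
  by apply/set0Pn; rewrite -card_gt0; move: J1; rewrite (cardsD1 i) iJ; card_lia.
rewrite !inE => /andP[/eqP ji jJ]; apply: ji; apply/esym; apply: mu_row_eq M iJ jJ _.
move=> w c wX iw; have : w \in [set v in X | A i v != None] by rewrite inE wX iw.
by rewrite w0 inE.
Qed.

(** The assignment leaves deficiency at most [k], hence a degree at most [k.*2]; each deleted row
    adds at most one. *)
Lemma low_deg_assign A J X v b k : mu A J X -> saturated A J X -> occ A J X ->
  v \in X -> (forall w, w \in X -> deg A J v <= deg A J w) -> 1 < #|X| ->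
  #|J| <= #|X| + k + ldeg A J v b - 1 ->
  exists2 w, w \in X :\ v & deg A J w <= k.*2 + ldeg A J v b.
Proof.
move=> M S O vX vmin X1 le; have cX := cardsD1 v X; rewrite vX /= in cX.
have X0 : X :\ v != set0 by rewrite -card_gt0; card_lia.
have cJ := card_assign A J v b.
have le' : #|assign A J v b| <= #|X :\ v| + k by card_lia.
have [w wX dw] := low_deg_exists (mu_assign b M S vX) (occ_assign_min b M O vX vmin) X0 le'.
by exists w => //; apply: leq_trans (deg_assign A J v b w) _; rewrite leq_add2r.
Qed.

Lemma delta6_low_deg A J X : mu A J X -> #|J| = #|X| + 6 ->
  exists2 v, v \in X & deg A J v <= 8.
Proof.
move=> M0 JX; apply/exists_inP; apply: contraT => /exists_inPn d0; exfalso.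
have {}d0 v : v \in X -> 9 <= deg A J v by move=> /d0; rewrite -ltnNge.
have [n] := ubnP #|X|; elim: n A J X M0 JX d0 => // n IHn A0 J X M0 JX d0 ltn.
have [A AA [M S]] := mu_saturate M0.
have d9 v : v \in X -> 9 <= deg A J v.
  by move=> vX; apply: leq_trans (d0 v vX) (extends_deg J v AA).
have O : occ A J X by apply: occ_deg => v /d9; card_lia.
have J1 : 1 < #|J| by card_lia.
(* The literal of a unit row occurs in no other row. Setting it true removes one row and one
   variable, which keeps the deficiency and all other degrees. *)
have wd i : i \in J -> 1 < width A X i.
  move=> iJ; rewrite ltnNge; apply/negP => w1.
  have /eqP /cards1P [x E] : width A X i = 1.
    by have := mu_width_gt0 M J1 iJ; card_lia.
  have onlyx w : w \in X -> A i w != None -> w = x.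
    by move=> wX iw; apply/set1P; rewrite -E inE wX.
  have : x \in [set v in X | A i v != None] by rewrite E set11.
  rewrite inE => /andP[xX]; case ix: (A i x) => [c|//] _.
  have rowx j : j \in J -> A j x = Some c -> j = i.
    move=> jJ jx; apply/esym; apply: (mu_row_eq M) => // w d wX iw.
    have wx : w = x by apply: onlyx; rewrite ?iw.
    by rewrite wx jx -ix -wx.
  have l1 : ldeg A J x c = 1.
    rewrite /ldeg; have -> : [set j in J | A j x == Some c] = [set i]; last exact: cards1.
    apply/setP => j; rewrite !inE; apply/andP/eqP => [[jJ /eqP /(rowx j jJ) //]|->].
    by rewrite iJ ix eqxx.
  have cX := cardsD1 x X; rewrite xX /= in cX.
  have cJ := card_assign A J x c.
  apply: (IHn A (assign A J x c) (X :\ x)); [exact: mu_assign|card_lia| |card_lia].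
  move=> w; rewrite !inE => /andP[wx wX]; apply: leq_trans (d9 w wX) _.
  apply: subset_leq_card; apply/subsetP => j; rewrite !inE => /andP[jJ jw].
  rewrite jJ jw andbT /=; apply: contra wx => /eqP /(rowx j jJ) ji.
  by apply/eqP/onlyx; rewrite // -ji.
have X0 : X != set0.
  have [i iJ] : exists i, i \in J by apply/set0Pn; rewrite -card_gt0; card_lia.
  have := wd i iJ; rewrite -card_gt0; apply: contraTT; rewrite -!leqNgt leqn0.
  move=> /eqP/cards0_eq ->; rewrite /width.
  rewrite (_ : [set v in set0 | _] = set0) ?cards0 //.
  by apply/setP => z; rewrite !inE.
have [v vX vmin] := min_deg_exists A J X0.
have cX := cardsD1 v X; rewrite vX /= in cX.
have X1 : 1 < #|X| by have := deg_le_card A J v; have := d9 v vX; card_lia.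
(* Six occurrences would leave deficiency 1, hence a variable of degree at most 2 + 6 = 8. *)
have l5 b : ldeg A J v b <= 5.
  have l6 := min_ldeg_bound b M S O vX vmin.
  rewrite leqNgt; apply/negP => l.
  have [|w] := @low_deg_assign A J X v b 1 M S O vX vmin X1; first by card_lia.
  by rewrite inE => /andP[_ /d9]; card_lia.
have [b lb] : exists b, ldeg A J v b = 5.
  have := l5 true; have := l5 false; have := d9 v vX; rewrite card_deg => d lf lt.
  have [E|E] := eqVneq (ldeg A J v true) 5; first by exists true.
  by exists false; move/eqP: E; card_lia.
(* Five deleted rows leave deficiency 2, so some degree, and with it that of [v], is at most 4 + 5 =
   9. *)
have lnb : ldeg A J v (~~ b) = 4.
  have [|w] := @low_deg_assign A J X v b 2 M S O vX vmin X1; first by card_lia.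
  rewrite inE => /andP[_ /vmin]; have := d9 v vX; rewrite (deg_ldeg A J v b).
  card_lia.
pose G := assign A J v b; pose H := assign A J v (~~ b); pose Y := X :\ v.
have YX : Y \subset X by apply: subsetDl.
have cG := card_assign A J v b; have cH := card_assign A J v (~~ b).
have hH : #|H| = #|Y| + 3 by rewrite /H /Y; card_lia.
have Y1 : 1 < #|Y|.
  by rewrite /Y; have := deg_le_card A J v; have := d9 v vX; card_lia.
have MG : mu A G Y := mu_assign b M S vX.
have MH : mu A H Y := mu_assign (~~ b) M S vX.
have dG z : z \in Y -> 4 <= deg A G z.
  move=> /(subsetP YX) /d9; have := deg_assign A J v b z; rewrite -/G; card_lia.
have dH z : z \in Y -> 5 <= deg A H z.
  move=> /(subsetP YX) /d9; have := deg_assign A J v (~~ b) z; rewrite -/H; card_lia.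
have [A2 AA2 [MH2 SH2]] := mu_saturate MH.
have OH2 : occ A2 H Y.
  by apply: (extends_occ AA2); apply: occ_deg => z /dH; card_lia.
have Y0 : Y != set0 by rewrite -card_gt0; card_lia.
have [u uY umin] := min_deg_exists A2 H Y0.
have cY := cardsD1 u Y; rewrite uY /= in cY.
have l3 c : ldeg A2 H u c <= 3.
  by have := min_ldeg_bound c MH2 SH2 OH2 uY umin; card_lia.
have du : 5 <= deg A2 H u := leq_trans (dH u uY) (extends_deg H u AA2).
have [c lc] : exists c, ldeg A2 H u c = 3.
  have := l3 true; have := l3 false; move: du; rewrite card_deg => d lf lt.
  have [E|E] := eqVneq (ldeg A2 H u true) 3; first by exists true.
  by exists false; move/eqP: E; card_lia.
(* Setting [u] to [c] takes [H] from deficiency 3 to 1, which gives a degree at most 2 + 3 = 5. *)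
have [w wYu dw] : exists2 w, w \in Y :\ u & deg A2 H w <= 5.
  have [|w wYu] := @low_deg_assign A2 H Y u c 1 MH2 SH2 OH2 uY umin Y1; first by card_lia.
  by rewrite lc; exists w.
move: wYu; rewrite in_setD1 => /andP[wu wY].
have du5 : deg A2 H u = 5.
  by apply/eqP; rewrite eqn_leq du andbT (leq_trans (umin w wY) dw).
have allH z : z \in Y -> deg A2 H z <= 5 ->
    forall i, i \in J -> A i v = Some (~~ b) -> A i z != None.
  move=> zY dz; apply: deg_assign_all; rewrite lnb -/H.
  have := d9 z (subsetP YX _ zY); have := extends_deg H z AA2; card_lia.
(* A row of [G] either lacks [v] and keeps its width, or contains the opposite literal of [v] and
   thus both [u] and [w]. *)
have wdG i : i \in G -> 1 < width A Y i.
  rewrite inE => /andP[iJ iv]; case E: (A i v) => [d|]; last first.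
    have := wd i iJ; rewrite /width; congr (1 < _); apply: eq_card => z.
    rewrite !inE; case: (eqVneq z v) => [->|//]; by rewrite E andbF.
  have dnb : A i v = Some (~~ b) by move: iv; rewrite E; case: (d) (b) => [] [].
  apply/card_gt1P; exists u, w; rewrite eq_sym; split=> //; rewrite inE ?uY ?wY /=.
    by apply: (allH u uY) dnb; rewrite ?du5.
  exact: (allH w wY) dnb.
have [A1 AA1 [MG1 SG1]] := mu_saturate MG.
have dG1 : forall z, z \in Y -> deg A1 G z <= 4.
  apply: delta2_deg => // [|z zY|i iG].
  - by rewrite /G /Y; card_lia.
  - by apply: leq_trans (dG z zY) (extends_deg G z AA1).
  - apply: leq_trans (wdG i iG) _; apply: subset_leq_card.
    apply/subsetP => z; rewrite !inE => /andP[->] /=.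
    by case Ez: (A i z) => [d|//] _; rewrite (AA1 _ _ _ Ez).
(* At least nine occurrences, at most four of them in [G], put [z] in all five rows deleted for
   [G]. *)
have full i z : i \in J -> A i v = Some b -> z \in Y -> A2 i z != None.
  move=> iJ iv zY; have : A i z != None.
    apply: (@deg_assign_all A J v b z) iJ iv; rewrite lb -/G.
    have := d9 z (subsetP YX _ zY); have := extends_deg G z AA1.
    have := dG1 z zY; card_lia.
  by case Ez: (A i z) => [d|//] _; rewrite (AA2 _ _ _ Ez).
(* The five rows survive in [H] and contain [u], whose degree there is 5, so they are all its
   occurrences. *)
have Eu : [set i in J | A i v == Some b] = [set i in H | A2 i u != None].
  apply/eqP; rewrite eqEcard -/(deg A2 H u) du5 -/(ldeg A J v b) lb andbT.
  apply/subsetP => i; rewrite !inE => /andP[iJ /eqP iv].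
  by rewrite iJ iv full // andbT; case: (b).
have := @full_rows_ldeg A2 H Y u c MH2 uY; rewrite lc => le.
have : 3 <= ldeg A2 H u (~~ c).
  apply: le => i z iH zY iu; have : i \in [set i in H | A2 i u != None] by rewrite inE iH.
  by rewrite -Eu inE => /andP[iJ /eqP iv]; apply: full.
by move: du5; rewrite (deg_ldeg A2 H u c) lc; card_lia.
Qed.

End Matrix.

(** * From clause-sets to matrices *)

Local Open Scope fset_scope.

Lemma mem_varC (C : clause) (x : lit) : x \in C -> x.1 \in varC C.
Proof. by move=> xC; rewrite in_imfset. Qed.

Lemma varCP (C : clause) v : reflect (exists b, (v, b) \in C) (v \in varC C).
Proof.
apply: (iffP (imfsetP _ _ _ _)) => [[[w b] /= wC ->]|[b vC]]; first by exists b.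
by exists (v, b).
Qed.

Lemma varFP (F : clauseset) v :
  reflect (exists2 C, C \in F & v \in varC C) (v \in varF F).
Proof.
rewrite /varF; apply: (iffP idP) => [/bigfcupP [C /andP[CF _] vC]|[C CF vC]].
  by exists C.
by apply/bigfcupP; exists C; rewrite ?CF.
Qed.

Lemma sub_varF (F : clauseset) C : C \in F -> varC C `<=` varF F.
Proof. by move=> CF; apply/fsubsetP => v vC; apply/varFP; exists C. Qed.

(** Testing the positive literal first is harmless, since a clause never contains both. *)
Definition clause_row (F : clauseset) (C : F) (v : varF F) : option bool :=
  if (val v, true) \in val C then Some true
  else if (val v, false) \in val C then Some false else None.

Lemma clause_rowE (F : clauseset) (C : F) (v : varF F) b : is_clauseset F ->
  (clause_row C v == Some b) = ((val v, b) \in val C).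
Proof.
move=> clF; rewrite /clause_row; case: ifP => [tC|tC].
  case: b => //; apply/esym/negbTE; exact: (clF _ (valP C) _ tC).
by case: ifP => [fC|fC]; case: b; rewrite ?tC ?fC.
Qed.

Definition satisfies (g : nat -> bool) (C : clause) :=
  has (fun x => g x.1 == x.2) (enum_fset C).

Lemma satisfiesP g (C : clause) :
  reflect (exists2 x, x \in C & g x.1 = x.2) (satisfies g C).
Proof. by apply: (iffP hasP) => -[x xC /eqP gx]; exists x. Qed.

Lemma falsified_row (F : clauseset) (C : F) (g : nat -> bool) : is_clauseset F ->
  falsified (@clause_row F) [set: varF F] [ffun v => g (val v)] C =
  ~~ satisfies g (val C).
Proof.
move=> clF; apply/falsifiedP/negP => [H /satisfiesP [[v b] /= vC gv]|H v _].
  have vF : v \in varF F by apply: (fsubsetP (sub_varF (valP C))); apply: mem_varC vC.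
  by have := H [` vF] (in_setT _); rewrite ffunE /= gv clause_rowE // vC.
rewrite ffunE clause_rowE //; apply/negP => vC.
by apply: H; apply/satisfiesP; exists (val v, g (val v)).
Qed.

Lemma MU_mu (F : clauseset) : MU F -> mu (@clause_row F) [set: F] [set: varF F].
Proof.
case=> clF [U M]; have un g : exists C : F, ~~ satisfies g (val C).
  apply/existsP; apply: contraT => /existsPn N; case: U; exists g => C CF.
  by apply/satisfiesP; have := N [` CF]; rewrite negbK.
apply/muP; split=> [f|C _].
  pose g v := if insub v is Some w then f w else true.
  have -> : f = [ffun v : varF F => g (val v)].
    by apply/ffunP => v; rewrite ffunE /g valK.
  by have [C nC] := un g; exists C; rewrite ?falsified_row.
have [g gs] := M _ (valP C); exists [ffun v => g (val v)].
have fu D : ~~ satisfies g (val D) -> D = C.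
  apply: contraNeq => DC; apply/satisfiesP/gs.
  by rewrite !inE (valP D) andbT; apply: contra DC => /eqP/val_inj ->.
apply/criticalP; split=> [|D _]; rewrite falsified_row //; last exact: fu.
by have [D nD] := un g; rewrite -(fu D).
Qed.

Lemma card_fset_filter (K : choiceType) (F : {fset K}) (P : pred K) :
  #|` [fset C in F | P C]| = #|[set C : F | P (val C)]|.
Proof.
rewrite cardE -(size_map val) cardfE cardE -(size_map val) /=.
apply: perm_size; apply: uniq_perm.
- by rewrite map_inj_uniq ?enum_uniq //; apply: val_inj.
- by rewrite map_inj_uniq ?enum_uniq //; apply: val_inj.
move=> C; apply/mapP/mapP => [[D _ ->]|[D]].
  have /= := valP D; rewrite !inE /= => /andP[DF PD].
  by exists [` DF] => //; rewrite mem_enum inE.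
rewrite mem_enum inE => PD ->.
have DF : val D \in [fset C in F | P C] by rewrite !inE (valP D).
by exists [` DF] => //; rewrite mem_enum.
Qed.

Lemma vdeg_deg (F : clauseset) (v : varF F) : is_clauseset F ->
  vdeg F (val v) = deg (@clause_row F) [set: F] v.
Proof.
move=> clF; rewrite card_deg /vdeg /ld !card_fset_filter; congr addn.
  by apply: eq_card => C; rewrite !inE clause_rowE.
by apply: eq_card => C; rewrite !inE clause_rowE.
Qed.

Lemma minvdeg_le (F : clauseset) v : v \in varF F -> minvdeg F <= vdeg F v.
Proof.
rewrite /minvdeg -[v \in _]/(v \in enum_fset (varF F)).
elim: (enum_fset (varF F)) => [|w s IHs]; first by rewrite in_nil.
rewrite inE big_cons => /orP[/eqP->|/IHs]; first exact: geq_minl.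
by move=> le; rewrite (leq_trans (geq_minr _ _)).
Qed.

Lemma minvdeg_ge (F : clauseset) m : m <= cF F ->
  (forall v, v \in varF F -> m <= vdeg F v) -> m <= minvdeg F.
Proof.
move=> mc H; rewrite /minvdeg big_seq; elim/big_ind: _ => // x y mx my.
by rewrite leq_min mx my.
Qed.

Lemma MU_delta6_minvdeg (F : clauseset) : MU_delta 6%:Z F -> minvdeg F <= 8.
Proof.
case=> MF dF; have clF : is_clauseset F by case: MF.
have [|v _] := delta6_low_deg (MU_mu MF).
  by move: dF; rewrite !cardsT -!cardfE /delta /cF /nF; lia.
by apply: leq_trans; rewrite -vdeg_deg //; apply: minvdeg_le (valP v).
Qed.

(** A full clause contains [v] or its complement, so it lies in the union of the two sets that
    [vdeg] counts. *)
Lemma nfc_minvdeg (F : clauseset) : is_clauseset F -> nfc F <= minvdeg F.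
Proof.
move=> clF; apply: minvdeg_ge => [|v vF].
  by apply: fsubset_leq_card; apply: fset_sub.
rewrite /nfc /vdeg /ld.
rewrite -cardfsUI; apply: leq_trans (leq_addr _ _); apply: fsubset_leq_card.
apply/fsubsetP => C; rewrite !inE /= => /andP[CF /eqP vC]; rewrite CF /=.
by move: vF; rewrite -vC => /varCP [[] ->]; rewrite ?orbT.
Qed.

Lemma UHIT_MU (F : clauseset) : UHIT F -> MU F.
Proof.
case=> clF [H U]; split=> //; split=> // C CF.
(* This assignment falsifies [C], so the clash with [C] gives every other clause a true literal. *)
exists (fun v => (v, false) \in C) => D; rewrite !inE => /andP[DC DF].
have [[v b] vD] := H D C DF CF DC; rewrite /compl /= => vC.
exists (v, b) => //=; case: b vD vC => //= vD vC.
by apply/negbTE; apply: (clF C CF _ vC).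
Qed.

Lemma UHIT_delta_MU_delta k (F : clauseset) : UHIT_delta k F -> MU_delta k F.
Proof. by case=> /UHIT_MU. Qed.

(** * A hitting clause-set with eight full clauses *)

Definition clause_of (s : seq lit) : clause := [fset x in s].

(** Clauses are first given as lists, whose finite properties can be checked by computation. *)
Definition full_lits : seq (seq lit) :=
  [seq (0, false) :: (1, b) :: t | b <- [:: true; false],
    t <- [seq [:: (2, c); (3, d)] | c <- [:: true; false], d <- [:: true; false]]].

(** The case of variable 0 true is split over all three other variables, the case of it false over
    variable 1 only. *)
Definition all_lits : seq (seq lit) :=
  [:: (0, true); (1, true)] :: [:: (0, true); (1, false)] :: full_lits.

Lemma full_lits_sub : {subset full_lits <= all_lits}.
Proof. by move=> s sf; apply: (@mem_drop 2 _ all_lits). Qed.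

Definition witness : clauseset := [fset C in map clause_of all_lits].

Lemma witnessP C : reflect (exists2 s, s \in all_lits & C = clause_of s) (C \in witness).
Proof. by rewrite in_fset; apply: mapP. Qed.

Lemma uniq_clauses (s : seq (seq lit)) : uniq s -> {subset s <= all_lits} ->
  uniq (map clause_of s).
Proof.
move=> us sub; rewrite map_inj_in_uniq // => x y /sub xs /sub ys E.
have test : all (fun s => all (fun t =>
  all (mem t) s && all (mem s) t ==> (s == t)) all_lits) all_lits by vm_compute.
apply/eqP; move/allP: test => /(_ x xs) /allP /(_ y ys) /implyP; apply.
have {}E z : (z \in x) = (z \in y) by have /fsetP /(_ z) := E; rewrite !in_fset.
by apply/andP; split; apply/allP => z; rewrite /= E.
Qed.

Lemma card_clauses (s : seq (seq lit)) : uniq s -> {subset s <= all_lits} ->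
  #|` [fset C in map clause_of s]| = size s.
Proof. by move=> us sub; rewrite card_fseq undup_id ?size_map // uniq_clauses. Qed.

Lemma varC_clause_of s : varC (clause_of s) =i map fst s.
Proof.
move=> v; apply/varCP/mapP => [[b]|[[w b] ws ->]]; last by exists b; rewrite inE.
by rewrite inE => vs; exists (v, b).
Qed.

Lemma varC_full s : s \in full_lits -> varC (clause_of s) = [fset v in iota 0 4].
Proof.
move=> sf; apply/fsetP => v; rewrite varC_clause_of in_fset.
have test : all (fun s : seq lit => map fst s == iota 0 4) full_lits by vm_compute.
by have /eqP-> := allP test s sf.
Qed.

Lemma varF_witness : varF witness = [fset v in iota 0 4].
Proof.
apply/eqP; rewrite eqEfsubset; apply/andP; split; apply/fsubsetP => v.
  case/varFP=> C /witnessP [s sA ->]; rewrite varC_clause_of in_fset.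
  have test : all (fun s : seq lit => all (mem (iota 0 4)) (map fst s)) all_lits.
    by vm_compute.
  by move=> vs; have /allP /(_ v vs) := allP test s sA.
pose s := [:: (0, false); (1, true); (2, true); (3, true)] : seq lit.
rewrite -(@varC_full s) // => vs; apply/varFP; exists (clause_of s) => //.
by apply/witnessP; exists s.
Qed.

Lemma witness_UHIT : UHIT witness.
Proof.
split; [|split].
- move=> C /witnessP [s sA ->] x; rewrite !inE => xs.
  have test : all (fun s => all (fun x => compl x \notin s) s) all_lits by vm_compute.
  by have /allP /(_ x xs) := allP test s sA.
- move=> C D /witnessP [s sA ->] /witnessP [t tA ->] st.
  have test : all (fun s : seq lit => all (fun t : seq lit =>
    (s != t) ==> has (fun x => compl x \in t) s) all_lits) all_lits by vm_compute.
  have /allP /(_ t tA) /implyP H := allP test s sA.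
  have /H /hasP [x xs xt] : s != t by apply: contraNneq st => ->.
  by exists x; rewrite inE.
case=> f H.
(* The clause falsified by [f]: each literal opposes the value of [f]. *)
pose s : seq lit := if f 0 then [:: (0, false); (1, ~~ f 1); (2, ~~ f 2); (3, ~~ f 3)]
  else [:: (0, true); (1, ~~ f 1)].
have sA : s \in all_lits.
  by rewrite /s; case: (f 0) (f 1) (f 2) (f 3) => [] [] [] [].
have [|x] := H (clause_of s); first by apply/witnessP; exists s.
rewrite inE /s; case f0: (f 0); rewrite !inE.
  by case/or4P=> /eqP-> /=; rewrite ?f0 //; case: (f _).
by case/orP=> /eqP-> /=; rewrite ?f0 //; case: (f _).
Qed.

Lemma witness_delta : delta witness = Posz 6.
Proof.
by rewrite /delta /cF /nF varF_witness card_clauses // card_fseq undup_id // size_iota.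
Qed.

Lemma witness_nfc : 8 <= nfc witness.
Proof.
have -> : 8 = #|` [fset C in map clause_of full_lits]|.
  by rewrite card_clauses //; apply: full_lits_sub.
apply/fsubset_leq_card/fsubsetP => C; rewrite in_fset => /mapP [s sf ->].
rewrite in_fset; apply/andP; split; last by rewrite varC_full // varF_witness.
by apply/witnessP; exists s => //; apply: full_lits_sub.
Qed.

(* [N] does not compute since big operators are locked. *)
Fixpoint N_foldr (fuel k : nat) : nat :=
  if fuel is fuel'.+1 then
    if k <= 1 then 2 else
    foldr (fun i => maxn (minn (2 * i) (N_foldr fuel' (k - i + 1) + i))) 0
      (index_iota 2 k.+1)
  else 2.

Lemma Nfuel_foldr fuel k : Nfuel fuel k = N_foldr fuel k.
Proof.
elim: fuel k => //= fuel IH k; case: ifP => // _.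
under eq_bigr => i _ do rewrite IH.
by rewrite unlock.
Qed.

Lemma N6 : N 6 = 9.
Proof. by rewrite /N Nfuel_foldr; vm_compute. Qed.

Theorem theorem14p4 :
  sup_is (UHIT_delta 6%:Z) nfc 8 /\
  sup_is (MU_delta 6%:Z) nfc 8 /\
  minvdeg_class_is (UHIT_delta 6%:Z) 8 /\
  minvdeg_class_is (MU_delta 6%:Z) 8 /\
  8 = N 6 - 1.
Proof.
have wU : UHIT_delta 6%:Z witness by split; [exact: witness_UHIT|exact: witness_delta].
have wM := UHIT_delta_MU_delta wU.
have wn : 0 < nF witness by rewrite /nF varF_witness card_fseq.
have nle F : MU_delta 6%:Z F -> nfc F <= 8.
  by move=> MF; apply: leq_trans (MU_delta6_minvdeg MF); apply: nfc_minvdeg; case: MF => -[].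
have wnfc : nfc witness = 8 by apply/eqP; rewrite eqn_leq nle // witness_nfc.
have wdeg : minvdeg witness = 8.
  apply/eqP; rewrite eqn_leq MU_delta6_minvdeg // -{1}wnfc.
  by apply: nfc_minvdeg; case: wU => -[].
rewrite N6; do !split.
- by move=> F /UHIT_delta_MU_delta /nle.
- by exists witness.
- exact: nle.
- by exists witness.
- by move=> F [/UHIT_delta_MU_delta /MU_delta6_minvdeg].
- by exists witness.
- by move=> F [/MU_delta6_minvdeg].
- by exists witness.
Qed.
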